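(* Let $X, Y$ be (nonzero) Banach spaces. Suppose that every element of $X \widehat{\otimes}_\pi Y$ attains its projective norm. Then the set of norm-attaining operators from $X$ into $Y^*$ is dense in $\mathcal{L}(X,Y^* )$; that is, if $\operatorname{NA}_\pi(X\widehat{\otimes}_\pi Y)=X\widehat{\otimes}_\pi Y$, then $\overline{\operatorname{NA}(X,Y^* )}^{\|\cdot\|}=\mathcal{L}(X,Y^* )$.
   Context: Banach spaces are over $\mathbb{K}\in\{\mathbb{R},\mathbb{C}\}$. $\mathcal{L}(X,Z)$ is the space of bounded linear operators with the operator norm, and $\operatorname{NA}(X,Z)$ is the set of $T\in\mathcal{L}(X,Z)$ for which there is $x_0\in S_X$ (the unit sphere) with $\|T(x_0)\|=\|T\|$. $X \widehat{\otimes}_\pi Y$ is the projective tensor product, the completion of $X \otimes Y$ under $\|z\|_\pi = \inf\{\sum_{n=1}^\infty \|x_n\|\|y_n\| : z = \sum_{n=1}^\infty x_n \otimes y_n,\ \sum_n\|x_n\|\|y_n\|<\infty\}$. $\operatorname{NA}_\pi(X \widehat{\otimes}_\pi Y)$ is the set of $z$ which attain their projective norm, i.e. for which there is a bounded sequence $(x_n,y_n)\subseteq X\times Y$ with $\sum_n\|x_n\|\|y_n\|<\infty$, $z=\sum_n x_n\otimes y_n$ and $\|z\|_\pi=\sum_n\|x_n\|\|y_n\|$. *)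

(* Defs.v *)
From HB Require Import structures.
From mathcomp Require Import all_boot all_order all_algebra sesquilinear.
From mathcomp Require Import complex.
From mathcomp Require Import all_classical all_reals all_analysis.
From mathcomp Require Import ring lra.

Set Implicit Arguments.
Unset Strict Implicit.
Unset Printing Implicit Defensive.

Import Order.TTheory GRing.Theory Num.Theory.
Import numFieldNormedType.Exports.

Local Open Scope classical_set_scope.
Local Open Scope ring_scope.

Variant scalar_kind := RealScalars | ComplexScalars.

Definition scalars (R : realType) (k : scalar_kind) : numFieldType :=
  match k with RealScalars => R | ComplexScalars => R[i] end.

(* A norm on a [normedModType K] takes its values in K; [ofR] and [toR]
   identify R with the real elements of K, so that infima, suprema and limits
   of norms can be taken in R. *)
Definition ofR {R : realType} {k : scalar_kind} : R -> scalars R k :=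
  match k return R -> scalars R k with
  | RealScalars => fun r => r
  | ComplexScalars => fun r => (r +i* 0)%C
  end.

Definition toR {R : realType} {k : scalar_kind} : scalars R k -> R :=
  match k return scalars R k -> R with
  | RealScalars => fun x => x
  | ComplexScalars => fun x => complex.Re x
  end.

Section scalars_theory.
Context {R : realType} {k : scalar_kind}.
Local Notation K := (scalars R k).
Implicit Types (r s : R) (x y : K).

Lemma ofRK r : toR (ofR r : K) = r.
Proof. by case: k. Qed.

Lemma toRK x : 0 <= x -> ofR (toR x) = x.
Proof.
rewrite /ofR /toR /scalars; case: k x => //= -[a b].
by rewrite lecE /= => /andP[/eqP -> _].
Qed.

Lemma ofRD r s : ofR (r + s) = ofR r + ofR s :> K.
Proof. by rewrite /ofR /scalars; case: k => //=; simpc. Qed.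

Lemma ofRM r s : ofR (r * s) = ofR r * ofR s :> K.
Proof. by rewrite /ofR /scalars; case: k => //=; simpc. Qed.

Lemma ofR0 : ofR 0 = 0 :> K.
Proof. by case: k. Qed.

Lemma ofR1 : ofR 1 = 1 :> K.
Proof. by case: k. Qed.

Lemma ler_ofR r s : (ofR r <= ofR s :> K) = (r <= s).
Proof.
by rewrite /ofR /scalars; case: k => //=; rewrite lecE /= eqxx.
Qed.

Lemma ofR_inj : injective (ofR : R -> K).
Proof. by move=> r s rs; rewrite -(ofRK r) rs ofRK. Qed.

Lemma ltr_ofR r s : (ofR r < ofR s :> K) = (r < s).
Proof. by rewrite !lt_def ler_ofR (inj_eq ofR_inj). Qed.

Lemma ofR_ge0 r : (0 <= ofR r :> K) = (0 <= r).
Proof. by rewrite -ofR0 ler_ofR. Qed.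

Lemma ofR_gt0 r : (0 < ofR r :> K) = (0 < r).
Proof. by rewrite -ofR0 ltr_ofR. Qed.

Lemma toR_ge0 x : 0 <= x -> 0 <= toR x.
Proof. by move=> x0; rewrite -ofR_ge0 toRK. Qed.

Definition rnorm (V : normedZmodType K) (v : V) : R := toR `|v|.

Lemma rnormE (V : normedZmodType K) (v : V) : ofR (rnorm v) = `|v|.
Proof. exact/toRK. Qed.

Lemma rnorm_ge0 (V : normedZmodType K) (v : V) : 0 <= rnorm v.
Proof. exact/toR_ge0. Qed.

Lemma rnormD (V : normedZmodType K) (v w : V) :
  rnorm (v + w) <= rnorm v + rnorm w.
Proof. by rewrite -ler_ofR ofRD !rnormE ler_normD. Qed.

Lemma rnorm0 (V : normedZmodType K) : rnorm (0 : V) = 0.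
Proof. by apply/ofR_inj; rewrite rnormE normr0 ofR0. Qed.

Lemma rnormZ (V : normedModType K) (a : K) (v : V) :
  rnorm (a *: v) = rnorm (a : K^o) * rnorm v.
Proof. by apply/ofR_inj; rewrite ofRM !rnormE normrZ. Qed.

End scalars_theory.

Definition bounded_linear {K : numFieldType} {V W : normedModType K} (f : V -> W) :=
  linear f /\ exists M : K, forall v, `|f v| <= M * `|v|.

Definition bounded_linear_pred {K : numFieldType} {V W : normedModType K} : pred (V -> W) :=
  fun f => `[< bounded_linear f >].

Lemma bounded_linear_submod (K : numFieldType) (V W : normedModType K) :
  subsemimod_closed (@bounded_linear_pred K V W).
Proof.
split; first split.
- apply/asboolP; split; first by move=> a u v /=; rewrite scaler0 addr0.
  by exists 0 => v; rewrite normr0 mul0r.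
- move=> f g /asboolP[flin [M fM]] /asboolP[glin [N gN]]; apply/asboolP; split.
    by move=> a u v /=; rewrite addrfctE flin glin scalerDr addrACA.
  by exists (M + N) => v; rewrite (le_trans (ler_normD _ _))// mulrDl lerD.
- move=> c f /asboolP[flin [M fM]]; apply/asboolP; split.
    move=> a u v /=; rewrite !scalrfctE flin scalerDr.
    by rewrite !scalerA mulrC.
  by exists (`|c| * M) => v; rewrite normrZ -mulrA ler_wpM2l.
Qed.

HB.instance Definition _ (K : numFieldType) (V W : normedModType K) :=
  GRing.isSubmodClosed.Build K (V -> W) (@bounded_linear_pred K V W)
    (@bounded_linear_submod K V W).

Section bounded_operators.
Context {R : realType} {k : scalar_kind}.
Local Notation K := (scalars R k).
Variables V W : normedModType K.

Record bounded_op := BoundedOp {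
  op_fun :> V -> W;
  op_subproof : bounded_linear_pred op_fun }.

HB.instance Definition _ := [isSub for op_fun].
HB.instance Definition _ := [Choice of bounded_op by <:].
HB.instance Definition _ := [SubChoice_isSubLmodule of bounded_op by <:].

Implicit Types T : bounded_op.

Lemma op_linear T : linear T.
Proof. by case: T => f /= /asboolP[]. Qed.

HB.instance Definition _ T := GRing.isLinear.Build K V W *:%R T (op_linear T).

Definition opnorm T : R := sup [set rnorm (T v) | v in [set v | `|v| <= 1]].

Lemma opnorm_has_sup T :
  has_sup [set rnorm (T v) | v in [set v | `|v| <= 1]].
Proof.
split; first by exists (rnorm (T 0)), 0 => //=; rewrite normr0.
case: T => f /= /[dup] /asboolP[_ [M fM]] _; exists (toR `|M|) => _ [v /= v1 <-].
rewrite -(@ler_ofR _ k) rnormE toRK// (le_trans (fM v))//.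
have [v0|v0] := eqVneq v 0; first by rewrite v0 normr0 mulr0.
have M0 : 0 <= M.
  by have := le_trans (normr_ge0 _) (fM v); rewrite pmulr_lge0 ?normr_gt0.
by rewrite ger0_norm// ler_piMr.
Qed.

Lemma opnorm_ub T v : `|v| <= 1 -> rnorm (T v) <= opnorm T.
Proof.
move=> v1; have /ubP := sup_upper_bound (opnorm_has_sup T); apply.
by exists v.
Qed.

Lemma opnorm_ge0 T : 0 <= opnorm T.
Proof.
have T0 : rnorm (T 0) <= opnorm T by apply: opnorm_ub; rewrite normr0.
exact: le_trans (rnorm_ge0 _) T0.
Qed.

Lemma opnorm_le T (M : R) :
  (forall v, `|v| <= 1 -> rnorm (T v) <= M) -> opnorm T <= M.
Proof.
move=> TM; apply: ge_sup; first by case: (opnorm_has_sup T).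
by move=> _ [v v1 <-]; exact: TM.
Qed.

Lemma ler_opnorm T v : rnorm (T v) <= opnorm T * rnorm v.
Proof.
have [->|v0] := eqVneq v 0; first by rewrite linear0 !rnorm0 mulr0.
have v0' : `|v| != 0 by rewrite normr_eq0.
have : rnorm (T (`|v|^-1 *: v)) <= opnorm T.
  by apply: opnorm_ub; rewrite normrZ normfV normr_id mulVf.
rewrite linearZ -!(@ler_ofR _ k) ofRM !rnormE normrZ normfV normr_id.
by rewrite ler_pdivrMl ?normr_gt0// mulrC.
Qed.

Lemma opnormD S T : ofR (opnorm (S + T)) <= ofR (opnorm S) + ofR (opnorm T) :> K.
Proof.
rewrite -ofRD ler_ofR; apply: opnorm_le => v v1.
have {}v1 : rnorm v <= 1 by rewrite -(@ler_ofR _ k) rnormE ofR1.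
rewrite (_ : (S + T) v = S v + T v)// (le_trans (rnormD _ _))// lerD//.
  by rewrite (le_trans (ler_opnorm _ _))// ler_piMr// opnorm_ge0.
by rewrite (le_trans (ler_opnorm _ _))// ler_piMr// opnorm_ge0.
Qed.

Lemma opnormZ_le (a : K) T : ofR (opnorm (a *: T)) <= `|a| * ofR (opnorm T).
Proof.
rewrite -(toRK (normr_ge0 a)) -ofRM ler_ofR; apply: opnorm_le => v v1.
have {}v1 : rnorm v <= 1 by rewrite -(@ler_ofR _ k) rnormE ofR1.
rewrite (_ : (a *: T) v = a *: T v)// rnormZ ler_wpM2l ?rnorm_ge0//.
by rewrite (le_trans (ler_opnorm _ _))// ler_piMr// opnorm_ge0.
Qed.

Lemma opnormZ (a : K) T : ofR (opnorm (a *: T)) = `|a| * ofR (opnorm T).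
Proof.
apply/le_anti; rewrite opnormZ_le/=.
have [->|a0] := eqVneq a 0.
  by rewrite normr0 mul0r ofR_ge0 opnorm_ge0.
rewrite -ler_pdivlMl ?normr_gt0// -normfV.
by rewrite -{1}[T](scalerK a0) opnormZ_le.
Qed.

Lemma opnorm0_eq0 T : ofR (opnorm T) = 0 :> K -> T = 0.
Proof.
rewrite -ofR0 => /ofR_inj T0; apply/val_inj/funext => v /=.
apply/eqP; rewrite -normr_eq0 -rnormE -ofR0; apply/eqP; congr ofR.
apply/le_anti; rewrite rnorm_ge0 andbT.
by rewrite (le_trans (ler_opnorm _ _))// T0 mul0r.
Qed.

HB.instance Definition _ :=
  Lmodule_isNormed.Build K bounded_op opnormD opnormZ opnorm0_eq0.

End bounded_operators.

Definition dual {R : realType} {k : scalar_kind}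
    (V : normedModType (scalars R k)) :=
  bounded_op V (scalars R k)^o.

HB.instance Definition _ (R : realType) (k : scalar_kind)
    (V : normedModType (scalars R k)) :=
  NormedModule.copy (dual V) (bounded_op V (scalars R k)^o).

Definition norm_attaining {R : realType} {k : scalar_kind}
    (V W : normedModType (scalars R k)) : set (bounded_op V W) :=
  [set T : bounded_op V W | exists2 v0 : V, `|v0| = 1 & `|T v0| = `|T| ].
Arguments norm_attaining {R k} V W.

Record seminorm {R : realType} {k : scalar_kind} (V : lmodType (scalars R k)) :=
  Seminorm {
    seminorm_fun :> V -> R;
    seminormD : forall u v,
      seminorm_fun (u + v) <= seminorm_fun u + seminorm_fun v;
    seminormZ : forall (a : scalars R k) v,
      seminorm_fun (a *: v) = toR `|a| * seminorm_fun v }.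

(* The Hausdorff completion of a seminormed space: Cauchy sequences modulo null
   sequences, normed by the limit of the seminorms. When the seminorm is a norm
   this is the usual completion. *)
Section completion.
Context {R : realType} {k : scalar_kind} {V : lmodType (scalars R k)}.
Local Notation K := (scalars R k).
Variable p : seminorm V.

Lemma seminorm0 : p 0 = 0.
Proof. by rewrite -(scale0r 0) seminormZ normr0 -(@ofR0 R k) ofRK mul0r. Qed.

Lemma seminormN v : p (- v) = p v.
Proof. by rewrite -scaleN1r seminormZ normrN1 -(@ofR1 R k) ofRK mul1r. Qed.

Lemma seminorm_ge0 v : 0 <= p v.
Proof.
rewrite -(@pmulrn_lge0 _ _ 2)// mulr2n -{2}seminormN.
by rewrite (le_trans _ (seminormD _ _ _))// subrr seminorm0.
Qed.

Lemma seminormC u v : p (u - v) = p (v - u).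
Proof. by rewrite -seminormN opprB. Qed.

Lemma seminorm_dist u v w : p (u - w) <= p (u - v) + p (v - w).
Proof. by rewrite (le_trans _ (seminormD _ _ _))// addrA subrK. Qed.

Lemma ler_dist_seminorm u v : `|p u - p v| <= p (u - v).
Proof.
have := seminormD p (u - v) v; have := seminormD p (v - u) u.
rewrite !subrK seminormC => puv pvu; rewrite ler_norml; apply/andP.
by split; lra.
Qed.

Definition seminorm_cauchy (u : nat -> V) :=
  forall e : R, 0 < e -> exists N, forall m n,
    (N <= m)%N -> (N <= n)%N -> p (u m - u n) <= e.

Definition cauchy_pred : pred (nat -> V) := fun u => `[< seminorm_cauchy u >].

Lemma cauchy_submod : subsemimod_closed cauchy_pred.
Proof.
split; first split.
- apply/asboolP => e e0; exists 0 => m n _ _.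
  by rewrite subrr seminorm0 ltW.
- move=> u v /asboolP cu /asboolP cv; apply/asboolP => e e0.
  have e2 : 0 < e / 2 by rewrite divr_gt0.
  have [M uM] := cu _ e2; have [N vN] := cv _ e2.
  exists (maxn M N) => m n; rewrite !geq_max => /andP[Mm Nm] /andP[Mn Nn].
  rewrite /= opprD addrACA (le_trans (seminormD _ _ _))// [leRHS]splitr.
  by rewrite lerD ?uM ?vN.
- move=> a u /asboolP cu; apply/asboolP => e e0.
  have a1 : 0 < toR `|a| + 1 by rewrite ltr_wpDl// toR_ge0.
  have [N uN] := cu _ (divr_gt0 e0 a1).
  exists N => m n Nm Nn; rewrite !scalrfctE -scalerBr seminormZ.
  have := uN m n Nm Nn; rewrite ler_pdivlMr// => /(le_trans _); apply.
  by rewrite mulrC ler_wpM2l ?seminorm_ge0// lerDl.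
Qed.

HB.instance Definition _ :=
  GRing.isSubmodClosed.Build K (nat -> V) cauchy_pred cauchy_submod.

Record cauchy_seq := CauchySeq {
  cauchy_val :> nat -> V;
  cauchy_subproof : cauchy_pred cauchy_val }.

HB.instance Definition _ := [isSub for cauchy_val].
HB.instance Definition _ := [Choice of cauchy_seq by <:].
HB.instance Definition _ := [SubChoice_isSubLmodule of cauchy_seq by <:].

Lemma cauchy_seqP (u : cauchy_seq) : seminorm_cauchy u.
Proof. by case: u => u /= /asboolP. Qed.

Definition cauchy_null : pred cauchy_seq :=
  fun u => `[< (fun n => p (u n)) @ \oo --> (0 : R) >].

Lemma cauchy_null_submod : subsemimod_closed cauchy_null.
Proof.
split; first split.
- apply/asboolP; rewrite (_ : (fun n => _) = cst 0); first exact: cvg_cst.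
  by apply/funext => n; rewrite /= seminorm0.
- move=> u v /asboolP u0 /asboolP v0; apply/asboolP.
  have uv0 : (fun n => p (u n) + p (v n)) @ \oo --> (0 + 0 : R) by exact: cvgD.
  rewrite addr0 in uv0.
  apply: (@squeeze_cvgr _ _ _ _ (cst 0) (fun n => p (u n) + p (v n)) _ _ _
    (cvg_cst 0) uv0).
  by apply: nearW => n; rewrite seminorm_ge0 seminormD.
- move=> a u /asboolP u0; apply/asboolP.
  have au0 : (fun n => toR `|a| * p (u n)) @ \oo --> (toR `|a| * 0 : R).
    exact: cvgMl_tmp.
  rewrite mulr0 in au0.
  rewrite (_ : (fun n => _) = (fun n => toR `|a| * p (u n)))//.
  by apply/funext => n; rewrite -seminormZ.
Qed.

HB.instance Definition _ :=
  GRing.isSubmodClosed.Build K cauchy_seq cauchy_null cauchy_null_submod.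

Definition cauchy_null_closed := GRing.ZmodClosed.clone _ cauchy_null _.

Definition completion := Quotient.quot cauchy_null_closed.

HB.instance Definition _ := GRing.Zmodule.on completion.

Definition completion_class (u : cauchy_seq) : completion := (\pi u)%qT.

Lemma completion_ind (P : completion -> Prop) :
  (forall u, P (completion_class u)) -> forall z, P z.
Proof. by move=> Pu z; rewrite -[z]reprK; exact: Pu. Qed.

Lemma completion_classD u v :
  completion_class (u + v) = completion_class u + completion_class v.
Proof. by rewrite /completion_class !piE. Qed.

Lemma eq_completion_class u v :
  completion_class u = completion_class v <->
  (fun n => p (u n - v n)) @ \oo --> (0 : R).
Proof.
rewrite (rwP eqP) /completion_class -[X in is_true X](Quotient.idealrBE cauchy_null_closed).
by rewrite unfold_in; split=> /asboolP.
Qed.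

Definition completion_scale (a : K) (z : completion) : completion :=
  completion_class (a *: repr z).

Lemma completion_classZ a u :
  completion_scale a (completion_class u) = completion_class (a *: u).
Proof.
apply/eq_completion_class.
have /eq_completion_class : completion_class (repr (completion_class u))
  = completion_class u by exact: reprK.
set w := repr _ => h.
have ah : (fun n => toR `|a| * p (w n - u n)) @ \oo --> (toR `|a| * 0 : R).
  exact: cvgMl_tmp.
rewrite mulr0 in ah.
rewrite (_ : (fun n => _) = (fun n => toR `|a| * p (w n - u n)))//.
by apply/funext => n; rewrite -seminormZ scalerBr.
Qed.

Lemma completion_scalerA a b z :
  completion_scale a (completion_scale b z) = completion_scale (a * b) z.
Proof.
by elim/completion_ind: z => u; rewrite !completion_classZ scalerA.
Qed.

Lemma completion_scale1r : left_id 1 completion_scale.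
Proof. by elim/completion_ind=> u; rewrite completion_classZ scale1r. Qed.

Lemma completion_scalerDr : right_distributive completion_scale +%R.
Proof.
move=> a z w; elim/completion_ind: z => u; elim/completion_ind: w => v.
by rewrite -completion_classD !completion_classZ scalerDr completion_classD.
Qed.

Lemma completion_scalerDl z : {morph completion_scale^~ z : a b / a + b}.
Proof.
move=> a b; elim/completion_ind: z => u /=.
by rewrite !completion_classZ scalerDl completion_classD.
Qed.

HB.instance Definition _ := GRing.Zmodule_isLmodule.Build K completion
  completion_scalerA completion_scale1r completion_scalerDr completion_scalerDl.

Lemma completion_class_is_linear : linear completion_class.
Proof. by move=> a u v; rewrite completion_classD -completion_classZ. Qed.

HB.instance Definition _ := GRing.isLinear.Build K cauchy_seq completion *:%R
  completion_class completion_class_is_linear.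

Lemma cauchy_seminorm_cvg (u : cauchy_seq) :
  cvg ((fun n => p (u n)) @ \oo).
Proof.
apply: cauchy_cvg; apply: cauchy_exP => e e0.
have [N uN] := cauchy_seqP u (divr_gt0 e0 (ltr0n R 2)).
exists (p (u N)); exists N => // n /= Nn; rewrite /ball /=.
rewrite (le_lt_trans (ler_dist_seminorm _ _))//.
by rewrite (le_lt_trans (uN _ _ _ _))// ltr_pdivrMr// ltr_pMr// ltr1n.
Qed.

Definition completion_rnorm (z : completion) : R :=
  lim ((fun n => p (repr z n)) @ \oo).

Lemma completion_rnormP (u : cauchy_seq) :
  (fun n => p (u n)) @ \oo --> completion_rnorm (completion_class u).
Proof.
rewrite /completion_rnorm; set v := repr _.
have uv : (fun n => p (u n - v n)) @ \oo --> (0 : R).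
  by apply/eq_completion_class; rewrite /v [RHS]reprK.
have vl : (fun n => p (v n)) @ \oo --> lim ((fun n => p (v n)) @ \oo).
  exact: (@cauchy_seminorm_cvg v).
set l := lim _ in vl *.
have h : (fun n => p (v n) + p (u n - v n)) @ \oo --> (l + 0 : R) by exact: cvgD.
have g : (fun n => p (v n) - p (u n - v n)) @ \oo --> (l - 0 : R) by exact: cvgB.
rewrite subr0 in g; rewrite addr0 in h.
apply: (squeeze_cvgr _ g h); apply: nearW => n /=.
have := ler_dist_seminorm (u n) (v n); rewrite ler_norml.
by move=> /andP[? ?]; apply/andP; split; lra.
Qed.

Lemma completion_normD z w : ofR (completion_rnorm (z + w)) <=
  ofR (completion_rnorm z) + ofR (completion_rnorm w) :> K.
Proof.
rewrite -ofRD ler_ofR.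
elim/completion_ind: z => u; elim/completion_ind: w => v.
rewrite -completion_classD.
have uvl : (fun n => p (u n) + p (v n)) @ \oo -->
    completion_rnorm (completion_class u) + completion_rnorm (completion_class v).
  by apply: cvgD; exact: completion_rnormP.
apply: (ler_cvg_to (@completion_rnormP (u + v)) uvl).
by apply: nearW => n; exact: seminormD.
Qed.

Lemma completion_normZ a z :
  ofR (completion_rnorm (a *: z)) = `|a| * ofR (completion_rnorm z).
Proof.
elim/completion_ind: z => u; rewrite -linearZ.
rewrite -(toRK (normr_ge0 a)) -ofRM; congr ofR.
apply: (cvg_unique _ (@completion_rnormP (a *: u))) => //.
rewrite (_ : (fun n => _) = (fun n => toR `|a| * p (u n))).
  by apply: cvgMl_tmp; exact: completion_rnormP.
by apply/funext => n; rewrite -seminormZ.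
Qed.

Lemma completion_norm_eq0 z : ofR (completion_rnorm z) = 0 :> K -> z = 0.
Proof.
rewrite -ofR0 => /ofR_inj; elim/completion_ind: z => u u0.
rewrite -(linear0 completion_class); apply/eq_completion_class.
rewrite (_ : (fun n => _) = (fun n => p (u n))).
  by rewrite -u0; exact: completion_rnormP.
by apply/funext => n; rewrite subr0.
Qed.

HB.instance Definition _ := Lmodule_isNormed.Build K completion
  completion_normD completion_normZ completion_norm_eq0.

Lemma completion_rnormE (z : completion) : rnorm z = completion_rnorm z.
Proof. exact: ofRK. Qed.

Lemma completion_inj_subproof (v : V) : cauchy_pred (fun=> v).
Proof.
apply/asboolP => e e0; exists 0 => m n _ _.
by rewrite subrr seminorm0 ltW.
Qed.

Definition completion_inj (v : V) : completion :=
  completion_class (CauchySeq (completion_inj_subproof v)).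

Lemma completion_inj_is_linear : linear completion_inj.
Proof.
move=> a u v; rewrite /completion_inj -linearP; congr completion_class.
exact: val_inj.
Qed.

HB.instance Definition _ := GRing.isLinear.Build K V completion *:%R
  completion_inj completion_inj_is_linear.

Lemma rnorm_completion_inj v : rnorm (completion_inj v) = p v.
Proof.
rewrite completion_rnormE.
have /cvg_lim <- := @completion_rnormP (CauchySeq (completion_inj_subproof v)) => //.
by apply: cvg_lim; [exact: Rhausdorff | exact: (cvg_cst (p v))].
Qed.

Lemma completion_class_approx (u : cauchy_seq) (e : R) : 0 < e ->
  exists N, forall n, (N <= n)%N ->
    rnorm (completion_class u - completion_inj (u n)) <= e.
Proof.
move=> e0; have [N uN] := cauchy_seqP u e0; exists N => n Nn.
rewrite completion_rnormE -linearB.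
apply: (ler_cvg_to (@completion_rnormP _) (cvg_cst e)).
by exists N => // m /= Nm; exact: uN.
Qed.

Lemma completion_inj_dense (z : completion) (e : R) : 0 < e ->
  exists v, rnorm (z - completion_inj v) <= e.
Proof.
elim/completion_ind: z => u e0; have [N uN] := completion_class_approx u e0.
by exists (u N); exact: uN.
Qed.

Lemma completion_complete (F : set_system completion) :
  ProperFilter F -> cauchy F -> cvg F.
Proof.
move=> FF /cauchyP Fc.
have /choice[v Fv] : forall n : nat, exists v : V,
    F [set z | rnorm (z - completion_inj v) <= 2 / n.+1%:R].
  move=> n; have n0 : 0 < n.+1%:R^-1 :> R by [].
  have n0' : 0 < ofR n.+1%:R^-1 :> K by rewrite ofR_gt0.
  have [w Fw] := Fc _ n0'.
  have [v wv] := completion_inj_dense w n0; exists v.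
  apply: filterS Fw => z; rewrite -ball_normE /= -rnormE ltr_ofR => wz.
  rewrite -(subrK w z) -addrA (le_trans (rnormD _ _))//.
  rewrite [X in _ <= X * _](_ : 2 = 1 + 1)// mulrDl mul1r lerD//.
  by rewrite -(@ler_ofR _ k) rnormE distrC -rnormE ler_ofR ltW.
have small (e : R) : 0 < e ->
    exists N, forall n, (N <= n)%N -> 2 / n.+1%:R <= e :> R.
  move=> e0; exists (Num.truncn (2 / e)) => n Nn.
  rewrite ler_pdivrMr// -ler_pdivrMl// mulrC.
  apply: ltW; apply: lt_le_trans (truncnS_gt _) _.
  by rewrite ler_nat ltnS.
have vc : cauchy_pred v.
  apply/asboolP => e e0; have e2 : 0 < e / 2 by rewrite divr_gt0.
  have [N sN] := small _ e2; exists N => m n Nm Nn.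
  have [z [zm zn]] := filter_ex (filterI (Fv m) (Fv n)).
  rewrite -rnorm_completion_inj linearB /= -(subrK z (completion_inj (v m))).
  rewrite -addrA (le_trans (rnormD _ _))// [leRHS]splitr lerD//.
    rewrite -(@ler_ofR _ k) rnormE distrC -rnormE ler_ofR.
    exact: le_trans zm (sN _ Nm).
  exact: le_trans zn (sN _ Nn).
pose u := CauchySeq vc; apply/cvg_ex; exists (completion_class u).
apply/cvgrPdist_le => e e0.
have re : 0 < toR e by rewrite -(@ltr_ofR _ k) ofR0 toRK// ltW.
have e2 : 0 < toR e / 2 by rewrite divr_gt0.
have [N uN] := completion_class_approx u e2; have [M sM] := small _ e2.
pose n := maxn N M; apply: filterS (Fv n) => z zn.
rewrite -rnormE -(toRK (ltW e0)) ler_ofR.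
rewrite -(subrK (completion_inj (v n)) (completion_class u)) -addrA.
rewrite (le_trans (rnormD _ _))// [leRHS]splitr lerD//.
  by apply: uN; rewrite leq_maxl.
rewrite -(@ler_ofR _ k) rnormE distrC -rnormE ler_ofR (le_trans zn)//.
by apply: sM; rewrite leq_maxr.
Qed.

HB.instance Definition _ := Uniform_isComplete.Build completion completion_complete.

End completion.

(* The algebraic tensor product of X and Y is the space of functionals on the
   bilinear forms on X * Y spanned by the evaluations B |-> B x y. The forms are
   not assumed continuous: over a field they separate the points of the
   algebraic tensor product. *)
Section tensor.
Context {R : realType} {k : scalar_kind}.
Local Notation K := (scalars R k).
Variables X Y : normedModType K.

Definition bilinear_form := {bilinear X -> Y -> K^o}.

Definition tensor_pred : pred (bilinear_form -> K^o) := fun t =>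
  `[< exists s : seq (X * Y),
        t = fun B : bilinear_form => \sum_(xy <- s) B xy.1 xy.2 >].

Lemma tensor_submod : subsemimod_closed tensor_pred.
Proof.
split; first split.
- by apply/asboolP; exists [::]; apply/funext => B; rewrite big_nil.
- move=> t u /asboolP[s ->] /asboolP[s' ->]; apply/asboolP; exists (s ++ s').
  by apply/funext => B; rewrite big_cat.
- move=> a t /asboolP[s ->]; apply/asboolP.
  exists [seq (a *: xy.1, xy.2) | xy <- s]; apply/funext => B.
  rewrite big_map scalrfctE scaler_sumr; apply: eq_bigr => xy _.
  by rewrite linearZl_LR.
Qed.

HB.instance Definition _ :=
  GRing.isSubmodClosed.Build K (bilinear_form -> K^o) tensor_pred tensor_submod.

Record tensor := Tensor {
  tensor_val : bilinear_form -> K^o;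
  tensor_subproof : tensor_pred tensor_val }.

HB.instance Definition _ := [isSub for tensor_val].
HB.instance Definition _ := [Choice of tensor by <:].
HB.instance Definition _ := [SubChoice_isSubLmodule of tensor by <:].

Lemma tens_subproof x y : tensor_pred (fun B : bilinear_form => B x y).
Proof.
by apply/asboolP; exists [:: (x, y)]; apply/funext => B; rewrite big_seq1.
Qed.

Definition tens x y : tensor := Tensor (tens_subproof x y).

Lemma tens_is_bilinear : bilinear_for *:%R *:%R tens.
Proof.
split=> [y a x x'|x a y y']; apply/val_inj/funext => B /=.
  by rewrite linearPl.
by rewrite linearPr.
Qed.

HB.instance Definition _ :=
  bilinear_isBilinear.Build K X Y tensor *:%R *:%R tens tens_is_bilinear.

Definition tens_sum (s : seq (X * Y)) : tensor := \sum_(xy <- s) tens xy.1 xy.2.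

Lemma tens_sumP t : exists s, t = tens_sum s.
Proof.
case: t => t /[dup] /asboolP[s ts] tP; exists s; apply: val_inj.
rewrite /tens_sum raddf_sum fct_sumE /= ts; apply/funext => B.
by apply: eq_bigr.
Qed.

Definition cost (s : seq (X * Y)) : R := \sum_(xy <- s) rnorm xy.1 * rnorm xy.2.

(* On the algebraic tensor product the projective norm is the infimum over finite
   representations; [rnorm_proj_tensorE] below gives, for every element of the
   completion, the formula over infinite representations. [pi_norm] is a norm,
   but only the seminorm axioms are needed to form the completion. *)
Definition pi_norm (t : tensor) : R :=
  inf [set cost s | s in [set s | t = tens_sum s]].

Lemma cost_ge0 s : 0 <= cost s.
Proof. by apply: sumr_ge0 => xy _; rewrite mulr_ge0 ?rnorm_ge0. Qed.

Lemma pi_norm_has_inf t : has_inf [set cost s | s in [set s | t = tens_sum s]].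
Proof.
split; first by have [s ts] := tens_sumP t; exists (cost s), s.
by exists 0 => _ [s _ <-]; exact: cost_ge0.
Qed.

Lemma pi_norm_le s : pi_norm (tens_sum s) <= cost s.
Proof. by apply: ge_inf; [case: (pi_norm_has_inf (tens_sum s)) | exists s]. Qed.

Lemma pi_norm_approx t (e : R) : 0 < e ->
  exists2 s, t = tens_sum s & cost s < pi_norm t + e.
Proof.
move=> e0; have [_ [s ts <-] se] := inf_adherent e0 (pi_norm_has_inf t).
by exists s.
Qed.

Lemma pi_normD t u : pi_norm (t + u) <= pi_norm t + pi_norm u.
Proof.
apply/ler_addgt0Pr => e e0; have e2 : 0 < e / 2 by rewrite divr_gt0.
have [s ts sE] := pi_norm_approx t e2; have [s' us' s'E] := pi_norm_approx u e2.
have -> : t + u = tens_sum (s ++ s') by rewrite /tens_sum big_cat ts us'.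
rewrite (le_trans (pi_norm_le _))// /cost big_cat/= -/(cost s) -/(cost s').
by lra.
Qed.

Lemma pi_normZ_le (a : K) t : pi_norm (a *: t) <= toR `|a| * pi_norm t.
Proof.
apply/ler_addgt0Pr => e e0.
have a1 : 0 < toR `|a| + 1 by rewrite ltr_wpDl// toR_ge0.
have [s ts sE] := pi_norm_approx t (divr_gt0 e0 a1).
have -> : a *: t = tens_sum [seq (a *: xy.1, xy.2) | xy <- s].
  rewrite /tens_sum big_map ts scaler_sumr; apply: eq_bigr => xy _.
  by rewrite linearZl_LR.
rewrite (le_trans (pi_norm_le _))// /cost big_map.
under eq_bigr do rewrite /= rnormZ -mulrA.
rewrite -mulr_sumr -/(cost s).
apply: (@le_trans _ _ (toR `|a| * (pi_norm t + e / (toR `|a| + 1)))).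
  by rewrite ler_wpM2l ?toR_ge0// ltW.
rewrite mulrDr lerD2l mulrA ler_pdivrMr// mulrC ler_wpM2l ?(ltW e0)//.
by rewrite lerDl.
Qed.

Lemma pi_normZ (a : K) t : pi_norm (a *: t) = toR `|a| * pi_norm t.
Proof.
apply/le_anti; rewrite pi_normZ_le/=.
have pi_norm_ge0 u : 0 <= pi_norm u.
  by apply: lb_le_inf; [case: (pi_norm_has_inf u)|move=> _ [s _ <-]; exact: cost_ge0].
have [->|a0] := eqVneq a 0.
  by rewrite normr0 -(@ofR0 R k) ofRK mul0r.
have b0 : 0 < toR `|a| by rewrite -(@ofR_gt0 _ k) toRK ?normr_gt0.
rewrite -ler_pdivlMl//.
have -> : (toR `|a|)^-1 = toR `|a^-1|.
  apply: (mulfI (lt0r_neq0 b0)); rewrite divff ?lt0r_neq0//.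
  apply: (@ofR_inj _ k); rewrite ofRM !toRK// -normrM divff// normr1 ofR1//.
by rewrite -{1}[t](scalerK a0) pi_normZ_le.
Qed.

Definition pi_seminorm : seminorm tensor := Seminorm pi_normD pi_normZ.

Definition proj_tensor := completion pi_seminorm.

HB.instance Definition _ := CompleteNormedModule.on proj_tensor.

Definition ptens (x : X) (y : Y) : proj_tensor :=
  completion_inj pi_seminorm (tens x y).

(* [series u @ \oo --> rnorm z] says both that the sum of norms is finite and
   that its value is the projective norm of z. *)
Definition pi_attaining : set proj_tensor :=
  [set z | exists xy : nat -> X * Y,
    [/\ bounded_fun xy,
        series (fun n => rnorm (xy n).1 * rnorm (xy n).2) @ \oo --> rnorm z &
        series (fun n => ptens (xy n).1 (xy n).2) @ \oo --> z]].

End tensor.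

Arguments pi_attaining {R k} X Y.

Section proj_tensor_norm.
Context {R : realType} {k : scalar_kind}.
Local Notation K := (scalars R k).
Variables X Y : normedModType K.
Implicit Types (z : proj_tensor X Y) (s : seq (X * Y)) (xy : nat -> X * Y).

Let psum s := \sum_(xy <- s) ptens xy.1 xy.2.

Let psumE s : psum s = completion_inj (pi_seminorm X Y) (tens_sum s).
Proof. by rewrite /psum /tens_sum raddf_sum. Qed.

Let psum_approx z (d : R) : 0 < d ->
  exists s, rnorm (z - psum s) <= d /\ cost s <= rnorm z + d.
Proof.
move=> d0; have d2 : 0 < d / 2 by rewrite divr_gt0.
have [t zt] := completion_inj_dense z d2.
have [s ts sE] := pi_norm_approx t d2; exists s; rewrite psumE -ts; split.
  by rewrite (le_trans zt)// ler_pdivrMr// ler_peMr ?ler1n// ltW.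
have tz : pi_norm t <= rnorm z + d / 2.
  rewrite -[leLHS](rnorm_completion_inj (pi_seminorm X Y)).
  rewrite -(subrK z (completion_inj _ t)) addrC (le_trans (rnormD _ _))//.
  by rewrite lerD2l -(@ler_ofR _ k) rnormE distrC -rnormE ler_ofR.
lra.
Qed.

Let rnorm_ptens (x : X) (y : Y) : rnorm (ptens x y) <= rnorm x * rnorm y.
Proof.
rewrite rnorm_completion_inj.
have := pi_norm_le [:: (x, y)].
by rewrite /tens_sum /cost !big_seq1.
Qed.

Let rnorm_sum (I : Type) (r : seq I) (F : I -> X * Y) :
  rnorm (\sum_(i <- r) ptens (F i).1 (F i).2) <=
  \sum_(i <- r) rnorm (F i).1 * rnorm (F i).2.
Proof.
elim/big_rec2: _ => [|i a b _ ab]; first by rewrite rnorm0.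
by rewrite (le_trans (rnormD _ _))// lerD// rnorm_ptens.
Qed.

Lemma rnorm_proj_tensor_le z xy (c : R) :
  series (fun n => rnorm (xy n).1 * rnorm (xy n).2) @ \oo --> c ->
  series (fun n => ptens (xy n).1 (xy n).2) @ \oo --> z ->
  rnorm z <= c.
Proof.
set a := fun n => _ => ac /cvgrPdist_le xyz; apply/ler_addgt0Pr => e e0.
have e0' : 0 < ofR e :> K by rewrite ofR_gt0.
have [N _ /(_ N (leqnn N))] := xyz _ e0'.
rewrite /= -rnormE ler_ofR => zN.
rewrite -(subrK (series (fun n => ptens (xy n).1 (xy n).2) N) z) addrC.
rewrite (le_trans (rnormD _ _))// lerD//.
rewrite (le_trans (rnorm_sum _ _))// -/(series a N).
have nd : nondecreasing_seq (series a).
  by apply: nondecreasing_series => n _ _; rewrite mulr_ge0 ?rnorm_ge0.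
have := nondecreasing_cvgn_le nd (cvgP _ ac) N.
by rewrite (cvg_lim _ ac)//; exact: Rhausdorff.
Qed.

Lemma rnorm_proj_tensor_approx z (e : R) : 0 < e -> exists xy (c : R),
  [/\ series (fun n => rnorm (xy n).1 * rnorm (xy n).2) @ \oo --> c,
      series (fun n => ptens (xy n).1 (xy n).2) @ \oo --> z &
      c <= rnorm z + e].
Proof.
move=> e0; pose d n : R := e / 5 / 2 ^+ n.
have d0 n : 0 < d n by rewrite !divr_gt0// exprn_gt0.
have dS n : d n.+1 = d n / 2 by rewrite /d exprS invfM; field; rewrite expf_neq0.
have /choice[f fP] : forall wn : proj_tensor X Y * nat, exists s,
    rnorm (wn.1 - psum s) <= d wn.2 /\ cost s <= rnorm wn.1 + d wn.2.
  by move=> [w n]; exact: psum_approx.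
pose fix L n := if n is m.+1 then
  (L m ++ f (z - psum (L m), n)) ++ [:: (0, 0)] else f (z, 0) ++ [:: (0, 0)].
have psum_pad s : psum (s ++ [:: (0, 0)]) = psum s.
  rewrite {1}/psum big_cat big_seq1 /= (_ : ptens _ _ = 0) ?addr0//.
  by rewrite /ptens linear0l raddf0.
have cost_pad s : cost (s ++ [:: (0, 0)]) = cost s.
  by rewrite {1}/cost big_cat big_seq1 /= rnorm0 mul0r addr0.
have Lz n : rnorm (z - psum (L n)) <= d n.
  case: n => [|n] /=; rewrite psum_pad; first by have [] := fP (z, 0).
  rewrite {1}/psum big_cat/= -/(psum _) -/(psum _) opprD addrA.
  by have [] := fP (z - psum (L n), n.+1).
have Lc n : cost (L n) <= rnorm z + 5 * (e / 5) - 4 * d n.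
  elim: n => [|n ih] /=; rewrite cost_pad.
    have [_ /= h] := fP (z, 0); rewrite (le_trans h)// /d expr0 divr1; lra.
  rewrite {1}/cost big_cat/= -/(cost _) -/(cost _).
  have [_ /= h] := fP (z - psum (L n), n.+1).
  have := Lz n; have := d0 n; move: h ih; rewrite dS; lra.
have Lcz n : cost (L n) <= rnorm z + e.
  rewrite (le_trans (Lc n))//; have := d0 n; lra.
have Lsize n : (n < size (L n))%N.
  elim: n => [|n ih] /=; rewrite size_cat addn1// ltnS size_cat.
  exact: leq_trans ih (leq_addr _ _).
have Lnth n m i : (n <= m)%N -> (i < size (L n))%N ->
    nth 0 (L m) i = nth 0 (L n) i /\ (i < size (L m))%N.
  elim: m => [|m ih]; first by rewrite leqn0 => /eqP ->.
  rewrite leq_eqVlt => /predU1P[-> //|]; rewrite ltnS => nm iL.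
  have [<- im] := ih nm iL.
  by rewrite /= -catA nth_cat im size_cat ltn_addr.
pose xy n := nth 0 (L n) n.
have xyE n i : (i < size (L n))%N -> xy i = nth 0 (L n) i.
  move=> iL; have [ni|/ltnW ni] := leqP i n.
    by have [] := Lnth _ _ _ ni (Lsize i).
  by have [] := Lnth _ _ _ ni iL.
pose a n := rnorm (xy n).1 * rnorm (xy n).2.
have a_ge0 n : 0 <= a n by rewrite mulr_ge0 ?rnorm_ge0.
pose b n := ptens (xy n).1 (xy n).2.
have aL n : series a (size (L n)) = cost (L n).
  rewrite /cost (big_nth 0) /series /= big_nat [RHS]big_nat.
  by apply: eq_bigr => i /andP[_ iL]; rewrite /a (xyE n).
have bL n : series b (size (L n)) = psum (L n).
  rewrite /psum (big_nth 0) /series /= big_nat [RHS]big_nat.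
  by apply: eq_bigr => i /andP[_ iL]; rewrite /b (xyE n).
have nd : nondecreasing_seq (series a).
  by apply: nondecreasing_series => n _ _; exact: a_ge0.
have a_le n : series a n <= rnorm z + e.
  by rewrite (le_trans (nd _ _ (ltnW (Lsize n))))// aL.
have a_cvg : cvgn (series a).
  by apply: nondecreasing_is_cvgn => //; exists (rnorm z + e) => _ [n _ <-].
exists xy, (limn (series a)); split; first exact: a_cvg; last first.
  by apply: limr_le => //; apply: nearW.
apply/cvgrPdist_le => h' h'0; rewrite -(toRK (ltW h'0)).
set h := toR h'.
have h0 : 0 < h by rewrite -(@ofR_gt0 _ k) toRK// ltW.
have h2 : 0 < h / 2 by rewrite divr_gt0.
have d_cvg : d @ \oo --> (0 : R).
  rewrite (_ : d = geometric (e / 5) 2^-1).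
    by apply: cvg_geometric; rewrite ger0_norm// invf_lt1// ltr1n.
  by apply/funext => n; rewrite /d /geometric /= exprVn.
have [n dn an] : exists2 n, d n <= h / 2 & limn (series a) - series a n <= h / 2.
  have /cvgrPdist_le/(_ _ h2) lim_a := a_cvg.
  have /cvgrPdist_le/(_ _ h2) lim_d := d_cvg.
  have [n [nd' na]] := filter_ex (filterI lim_d lim_a); exists n.
    by rewrite (le_trans _ nd')// sub0r normrN ler_norm.
  by rewrite (le_trans _ na)// ler_norm.
exists (size (L n)) => // N /= nN; rewrite -rnormE ler_ofR.
rewrite -(subrK (series b (size (L n))) z) -addrA (le_trans (rnormD _ _))//.
rewrite [leRHS]splitr lerD//; first by rewrite bL (le_trans (Lz n)).
rewrite -(@ler_ofR _ k) rnormE distrC -rnormE ler_ofR sub_series_geq//.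
rewrite (le_trans (rnorm_sum _ _))// -/a -sub_series_geq// (le_trans _ an)//.
rewrite lerB//; first exact: nondecreasing_cvgn_le.
exact: nd (ltnW (Lsize n)).
Qed.

Lemma rnorm_proj_tensorE z : rnorm z = inf [set c : R | exists xy : nat -> X * Y,
  series (fun n => rnorm (xy n).1 * rnorm (xy n).2) @ \oo --> c /\
  series (fun n => ptens (xy n).1 (xy n).2) @ \oo --> z].
Proof.
set A := [set c | _].
have A_lb : lbound A (rnorm z).
  by move=> c [xy [ac bz]]; exact: rnorm_proj_tensor_le ac bz.
apply/le_anti/andP; split.
  apply: lb_le_inf => //.
  have [xy [c [ac bz _]]] := rnorm_proj_tensor_approx z ltr01.
  by exists c, xy.
apply/ler_addgt0Pr => e e0.
have [xy [c [ac bz ce]]] := rnorm_proj_tensor_approx z e0.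
by apply: le_trans ce; apply: ge_inf; [exists (rnorm z)|exists xy].
Qed.

End proj_tensor_norm.

(* Main.v *)
From HB Require Import structures.
Require Import Defs.
From mathcomp Require Import all_boot all_order all_algebra.
From mathcomp Require Import all_classical all_reals all_analysis.
From mathcomp Require Import complex ring lra.

Import Order.TTheory GRing.Theory Num.Theory.
Import numFieldNormedType.Exports.

Local Open Scope classical_set_scope.
Local Open Scope ring_scope.

(** Bounded operators from [X] into the dual of [Y] are the same thing as bounded
    functionals on the projective tensor product Z of [X] and [Y], an operator
    T corresponding to the functional that sends x (x) y to T x y. By the
    Bishop-Phelps theorem, the functional of T is within any e > 0 of some
    functional G that attains its norm, at a point z0 of the unit ball of Z. Let
    S be the operator of G, so that opnorm (S - T) <= e. As z0 attains its
    projective norm, it is a sum of tensors x_n (x) y_n with the sum of the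
    |x_n| |y_n| equal to |z0|. Then
<<
      |G| |z0| = G z0 = sum_n S x_n y_n <= sum_n |S| |x_n| |y_n| = |S| |z0|,
>>
    and |S| <= |G|, so that every term satisfies |S x_n y_n| = |S| |x_n| |y_n|.
    Any n with x_n and y_n nonzero gives a vector x_n at which S attains its norm
    ([norm_attaining_of_max]); if there is none, then z0 = 0, so that G = 0 and
    S = 0.

    The Bishop-Phelps theorem ([bishop_phelps]) rests on two facts. Ekeland's
    variational principle ([ekeland]) yields a point z0 of the unit ball B with
    f z <= f z0 + e |z - z0| on B. A Hahn-Banach argument ([mazur_orlicz]) then
    yields a functional h of norm at most e for which f + h is maximal on B at z0.

    Ordering and convexity concern real functionals, so this part of the
    argument deals with real parts, over the real space underlying Z
    ([realification]). A real functional is the real part of a unique K-linear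
    one ([linear_of_real_part]) and, by rotation, of the same norm
    ([rnorm_le_of_real_part]). *)

(** * Linear functionals below a sublinear one *)

Section sublinear.
Context {R : realType} {V : lmodType R}.
Implicit Types (p q : V -> R) (u v w a b : V) (r s t : R).

(** The inequality for scaling is equivalent to the equality, by rescaling with
    the inverse; it is the form that infima preserve. *)
Definition sublinear p :=
  (forall u v, p (u + v) <= p u + p v) /\
  (forall t v, 0 <= t -> p (t *: v) <= t * p v).

Lemma sublinear0 p : sublinear p -> p 0 = 0.
Proof.
move=> [pD pZ]; have := pD 0 0; rewrite addr0 => p00.
by have := pZ 0 0 (lexx 0); rewrite scale0r mul0r; lra.
Qed.

Lemma sublinearZ p t v : sublinear p -> 0 <= t -> p (t *: v) = t * p v.
Proof.
move=> ps; rewrite le_eqVlt => /predU1P[<-|t0].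
  by rewrite scale0r mul0r sublinear0.
apply/le_anti/andP; split; first exact/ps.2/ltW.
rewrite -ler_pdivlMl//.
have ti0 : 0 <= t^-1 by rewrite invr_ge0 ltW.
by have := ps.2 _ (t *: v) ti0; rewrite scalerA mulVf ?lt0r_neq0// scale1r.
Qed.

Lemma sublinearN p v : sublinear p -> - p (- v) <= p v.
Proof.
by move=> ps; have := ps.1 v (- v); rewrite subrr sublinear0//; lra.
Qed.

Definition convex_cone (A : set (V * R)) :=
  [/\ A (0, 0),
      (forall a r b s, A (a, r) -> A (b, s) -> A (a + b, r + s)) &
      (forall t a r, 0 <= t -> A (a, r) -> A (t *: a, t * r))].

(** The infimum of p (v + a) - r over the pairs (a, r) of the cone is a
    sublinear [q], finite because r <= p a, and v = - a bounds it by - r. Both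
    the linearity of minimal sublinear functionals and the Mazur-Orlicz theorem
    come from this construction. *)
Lemma sublinear_shrink p (A : set (V * R)) : sublinear p -> convex_cone A ->
  (forall a r, A (a, r) -> r <= p a) ->
  exists q, [/\ sublinear q, forall v, q v <= p v &
                forall a r, A (a, r) -> q (- a) <= - r].
Proof.
move=> ps [A0 AD AZ] Ap.
pose B v : set R := [set p (v + a.1) - a.2 | a in A].
have B_neq0 v : B v !=set0 by exists (p (v + 0) - 0), (0, 0).
have B_lb v : has_lbound (B v).
  exists (- p (- v)) => _ [[a r] /= Aar <-].
  by have := ps.1 (v + a) (- v); rewrite addrAC subrr add0r; have := Ap _ _ Aar; lra.
pose q v := inf (B v).
have q_le v a r : A (a, r) -> q v <= p (v + a) - r.
  by move=> Aar; apply: ge_inf => //; exists (a, r).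
have le_q v c : (forall a r, A (a, r) -> c <= p (v + a) - r) -> c <= q v.
  by move=> h; apply: lb_le_inf => // _ [[a r] Aar <-]; exact: h.
exists q; split; [split|..].
- move=> u v; rewrite -lerBlDr; apply: (le_q) => a r Aar.
  rewrite lerBlDr -lerBlDl; apply: (le_q) => b s Abs; rewrite lerBlDl.
  have := q_le (u + v) _ _ (AD _ _ _ _ Aar Abs).
  by rewrite addrACA; have := ps.1 (u + a) (v + b); lra.
- move=> t v t0.
  have qt a r : A (a, r) -> q (t *: v) <= t * (p (v + a) - r).
    move=> Aar; rewrite (le_trans (q_le _ _ _ (AZ _ _ _ t0 Aar)))//.
    by rewrite -scalerDr sublinearZ// mulrBr.
  move: t0 qt; rewrite le_eqVlt => /predU1P[<- /(_ _ _ A0)|t0 qt].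
    by rewrite !mul0r.
  by rewrite -ler_pdivrMl//; apply: (le_q) => a r /qt; rewrite ler_pdivrMl.
- by move=> v; have := q_le v _ _ A0; rewrite addr0 subr0.
- move=> a r /(q_le (- a)); by rewrite addNr sublinear0// sub0r.
Qed.

(** The infimum of a chain below [p] is finite because - p (- v) bounds every
    sublinear functional below [p] from below at v. *)
Lemma sublinear_chain_inf p (C : set (V -> R)) : C !=set0 ->
  (forall q, C q -> sublinear q /\ forall v, q v <= p v) ->
  total_on C (fun q q' => forall v, q' v <= q v) ->
  exists q, sublinear q /\ forall q', C q' -> forall v, q v <= q' v.
Proof.
move=> [q0 Cq0] Cp Ctot.
pose B v : set R := [set q v | q in C].
have B_neq0 v : B v !=set0 by exists (q0 v), q0.
have B_lb v : has_lbound (B v).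
  exists (- p (- v)) => _ [q Cq <-].
  have [qs qp] := Cp _ Cq; rewrite (le_trans _ (sublinearN _ _ qs))//.
  by rewrite lerN2.
pose q v := inf (B v).
have q_le q' v : C q' -> q v <= q' v by move=> Cq; apply: ge_inf => //; exists q'.
have le_q v c : (forall q', C q' -> c <= q' v) -> c <= q v.
  by move=> h; apply: lb_le_inf => // _ [q' Cq' <-]; exact: h.
exists q; split; last by move=> q' Cq' v; exact: q_le.
split=> [u v|t v t0].
- rewrite -lerBlDr; apply: (le_q) => q1 Cq1; rewrite lerBlDr -lerBlDl.
  apply: (le_q) => q2 Cq2; rewrite lerBlDl.
  have [le12|le21] := Ctot _ _ Cq1 Cq2.
    rewrite (le_trans (q_le _ (u + v) Cq2))//.
    by rewrite (le_trans ((Cp _ Cq2).1.1 u v))// lerD2r.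
  rewrite (le_trans (q_le _ (u + v) Cq1))//.
  by rewrite (le_trans ((Cp _ Cq1).1.1 u v))// lerD2l.
- have qt q' : C q' -> q (t *: v) <= t * q' v.
    by move=> Cq'; rewrite (le_trans (q_le _ _ Cq'))// (Cp _ Cq').1.2.
  move: t0 qt; rewrite le_eqVlt => /predU1P[<- /(_ _ Cq0)|t0 qt].
    by rewrite !mul0r.
  by rewrite -ler_pdivrMl//; apply: (le_q) => q' /qt; rewrite ler_pdivrMl.
Qed.

Lemma minimal_sublinear p : sublinear p ->
  exists q, [/\ sublinear q, forall v, q v <= p v &
    forall q', sublinear q' -> (forall v, q' v <= q v) -> q' = q].
Proof.
move=> ps; pose T := {q : V -> R | sublinear q /\ forall v, q v <= p v}.
pose below (q q' : T) := `[< forall v, sval q' v <= sval q v >].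
have sval_injT (q q' : T) : sval q = sval q' -> q = q'.
  by case: q q' => [q Hq] [q' Hq'] /= qq'; apply: eq_exist.
have [|||C Ctot|[q [qs qp]] qmin] := @Zorn T below.
- by move=> q; apply/asboolP.
- by move=> q1 q2 q3 /asboolP h12 /asboolP h23; apply/asboolP => v; exact: le_trans (h12 v).
- move=> q q' /asboolP h /asboolP h'; apply: sval_injT; apply/funext => v.
  by apply/le_anti; rewrite h h'.
- have [C0|/set0P[q0 Cq0]] := eqVneq C set0.
    have pT : sublinear p /\ forall v, p v <= p v by [].
    by exists (exist _ p pT) => q; rewrite C0.
  have [|_ [q Cq <-]|_ _ [q1 C1 <-] [q2 C2 <-]|q [qs qC]] :=
    @sublinear_chain_inf p (sval @` C).
  + by exists (sval q0), q0.
  + exact: (svalP q).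
  + by have [/asboolP|/asboolP] := Ctot _ _ C1 C2; [left|right].
  + have qp v : q v <= p v.
      have [_ q0p] := svalP q0; apply: le_trans (q0p v); apply: qC.
      by exists q0.
    exists (exist _ q (conj qs qp)) => q' Cq'; apply/asboolP => v /=.
    by apply: qC; exists q'.
exists q; split=> // q' q's q'q.
have q'p v : q' v <= p v by exact: le_trans (qp v).
have /qmin qq' : below (exist _ q (conj qs qp)) (exist _ q' (conj q's q'p)).
  exact/asboolP.
exact: (congr1 sval qq').
Qed.

(** A minimal [q] is linear: shrinking it along the ray of the pairs
    (t u, t q u) cannot change it, which says that q (- u) <= - q u. *)
Theorem hahn_banach p : sublinear p ->
  exists f : {linear V -> R^o}, forall v, f v <= p v.
Proof.
move=> /minimal_sublinear[q [qs qp qmin]].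
have qN u : q (- u) = - q u.
  have [|_ _ [t t0 [<- <-]]|q' [q's q'q q'u]] :=
    @sublinear_shrink q [set (t *: u, t * q u) | t in [set t : R | 0 <= t]] qs.
  - split.
    + by exists 0 => /=; rewrite ?scale0r ?mul0r.
    + move=> _ _ _ _ [t /= t0 [<- <-]] [t' /= t'0 [<- <-]].
      by exists (t + t'); rewrite /= ?addr_ge0// scalerDl mulrDl.
    + move=> t _ _ t0 [t' /= t'0 [<- <-]].
      by exists (t * t'); rewrite /= ?mulr_ge0// scalerA mulrA.
  - by rewrite sublinearZ.
  - have <- := qmin _ q's q'q; apply/le_anti/andP; split.
      have -> : q' u = q u by rewrite (qmin _ q's q'q).
      by apply: q'u; exists 1 => //=; rewrite scale1r mul1r.
    by have := sublinearN _ (- u) q's; rewrite opprK.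
have qD u v : q (u + v) = q u + q v.
  apply/le_anti; rewrite qs.1/=.
  by have := qs.1 (u + v) (- v); rewrite addrK qN; lra.
have qZ t v : q (t *: v) = t * q v.
  have [t0|t0] := leP 0 t; first exact: sublinearZ.
  rewrite -[t in LHS]opprK scaleNr qN sublinearZ ?oppr_ge0 ?ltW//.
  by rewrite mulNr opprK.
have qlin : linear (q : V -> R^o) by move=> t u v; rewrite qD qZ.
pose f : {linear V -> R^o} :=
  HB.pack (q : V -> R^o) (GRing.isLinear.Build R V R^o *:%R q qlin).
by exists f.
Qed.

(** This form of the Hahn-Banach theorem serves both to extend a functional from
    a subspace, when [A] is its graph, and to separate convex sets. *)
Theorem mazur_orlicz p (A : set (V * R)) : sublinear p -> convex_cone A ->
  (forall a r, A (a, r) -> r <= p a) ->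
  exists f : {linear V -> R^o},
    (forall v, f v <= p v) /\ forall a r, A (a, r) -> r <= f a.
Proof.
move=> ps Ac Ap; have [q [qs qp qA]] := sublinear_shrink _ _ ps Ac Ap.
have [f fq] := hahn_banach _ qs; exists f; split=> [v|a r /qA].
  exact: le_trans (qp v).
by have := fq (- a); rewrite linearN /=; lra.
Qed.

End sublinear.

Lemma hahn_banach_extension (R : realType) (V W : lmodType R)
    (j : {linear V -> W}) (p : W -> R) (f : {linear V -> R^o}) :
  sublinear p -> (forall v, f v <= p (j v)) ->
  exists g : {linear W -> R^o}, (forall w, g w <= p w) /\
                                forall v, g (j v) = f v.
Proof.
move=> ps fp.
have [|_ _ [v _ [<- <-]]//|g [gp gf]] :=
  @mazur_orlicz R W p (range (fun v => (j v, f v))) ps.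
  split.
  - by exists 0; rewrite // !linear0.
  - move=> _ _ _ _ [u _ [<- <-]] [v _ [<- <-]].
    by exists (u + v); rewrite // !linearD.
  - by move=> t _ _ _ [v _ [<- <-]]; exists (t *: v); rewrite // !linearZ.
exists g; split=> // v; apply/le_anti/andP; split; last by apply: gf; exists v.
have : f (- v) <= g (j (- v)) by apply: gf; exists (- v).
by rewrite !linearN lerN2.
Qed.

(** * Restriction of scalars to the reals *)

Definition realification {R : realType} {k : scalar_kind}
  (V : lmodType (scalars R k)) : Type := V.

Section realification.
Context {R : realType} {k : scalar_kind}.
Variable V : lmodType (scalars R k).

HB.instance Definition _ := GRing.Zmodule.copy (realification V) V.

Definition real_scale (t : R) (v : realification V) : realification V :=
  (ofR t : scalars R k) *: (v : V).

Lemma real_scalerA s t v : real_scale s (real_scale t v) = real_scale (s * t) v.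
Proof. by rewrite /real_scale scalerA ofRM. Qed.

Lemma real_scale1r : left_id 1 real_scale.
Proof. by move=> v; rewrite /real_scale ofR1 scale1r. Qed.

Lemma real_scalerDr : right_distributive real_scale +%R.
Proof. by move=> t u v; rewrite /real_scale -scalerDr. Qed.

Lemma real_scalerDl v : {morph real_scale^~ v : s t / s + t}.
Proof. by move=> s t; rewrite /real_scale ofRD scalerDl. Qed.

HB.instance Definition _ := GRing.Zmodule_isLmodule.Build R (realification V)
  real_scalerA real_scale1r real_scalerDr real_scalerDl.

End realification.

Section real_functionals.
Context {R : realType} {k : scalar_kind}.
Local Notation K := (scalars R k).

Lemma rnormB (V : normedModType K) (u v : V) : rnorm (u - v) = rnorm (v - u).
Proof. by rewrite /rnorm distrC. Qed.

Lemma rnorm_eq0 (V : normedModType K) (v : V) : rnorm v = 0 -> v = 0.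
Proof. by move=> v0; apply/eqP; rewrite -normr_eq0 -rnormE v0 ofR0. Qed.

Lemma rnorm_ofRZ (V : normedModType K) (t : R) (v : V) : 0 <= t ->
  rnorm ((ofR t : K) *: v) = t * rnorm v.
Proof.
move=> t0; rewrite rnormZ; congr (_ * _); apply: (@ofR_inj _ k).
by rewrite rnormE ger0_norm ?ofR_ge0.
Qed.

Lemma sublinear_rnorm (V : normedModType K) (c : R) : 0 <= c ->
  sublinear (fun v : realification V => c * rnorm (v : V)).
Proof.
move=> c0; split=> [u v|t v t0]; first by rewrite -mulrDr ler_wpM2l// rnormD.
by rewrite rnorm_ofRZ// mulrCA.
Qed.

Lemma lipschitz_continuous (V : normedModType K) (f : V -> R) (c : R) :
  0 <= c -> (forall u v, f u - f v <= c * rnorm (u - v)) -> continuous f.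
Proof.
move=> c0 fc v; apply/cvgrPdist_le => e e0.
have d0 : 0 < e / (c + 1) by rewrite divr_gt0// ltr_wpDl.
have d0' : 0 < ofR (e / (c + 1)) :> K by rewrite ofR_gt0.
apply: filterS (nbhsx_ballx v _ d0') => u; rewrite -ball_normE /= -rnormE ltr_ofR.
move=> /ltW vu; rewrite ler_norml lerNl opprB.
have ce : c * rnorm (v - u) <= e.
  move: vu; rewrite ler_pdivlMr ?ltr_wpDl// => /(le_trans _); apply.
  by rewrite mulrC ler_wpM2l ?rnorm_ge0// lerDl.
by rewrite !(le_trans (fc _ _))// rnormB.
Qed.

Lemma rnorm_continuous (V : normedModType K) : continuous (@rnorm R k V).
Proof.
apply: (@lipschitz_continuous _ _ 1) => // u v; rewrite mul1r lerBlDr.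
by rewrite -{1}(subrK v u) rnormD.
Qed.

End real_functionals.

(** * The Bishop-Phelps theorem *)

Section bishop_phelps.
Context {R : realType} {k : scalar_kind}.
Local Notation K := (scalars R k).

(** For the order e * rnorm (w - z) <= f w - f z there is a maximal element
    above any point. Each step of the sequence [u] gains at least half of what
    can still be gained. The gains are summable, hence so are the distances,
    which they dominate, and at the limit nothing is left to gain. *)
Lemma ekeland (Z : completeNormedModType K) (B : set Z) (f : Z -> R) (e : R) :
  0 < e -> closed B -> B !=set0 -> has_ubound (f @` B) -> continuous f ->
  exists2 z0, B z0 & forall z, B z -> f z <= f z0 + e * rnorm (z - z0).
Proof.
move=> e0 Bcl [b0 Bb0] fub fcont.
pose above z : set Z := [set w | B w /\ e * rnorm (w - z) <= f w - f z].
have above_refl z : B z -> above z z by move=> Bz; split=> //; rewrite !subrr rnorm0 mulr0.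
have above_trans x y z : above x y -> above y z -> above x z.
  move=> [_ xy] [Bz yz]; split=> //.
  have : e * rnorm (z - x) <= e * (rnorm (z - y) + rnorm (y - x)).
    by rewrite ler_wpM2l ?(ltW e0)// -{1}(subrK y z) -addrA rnormD.
  by rewrite mulrDr; lra.
have above_le x y : above x y -> f x <= f y.
  by move=> [_ xy]; rewrite -subr_ge0 (le_trans _ xy)// mulr_ge0 ?rnorm_ge0 ?ltW.
have /choice[next nextP] : forall z, exists w, B z ->
    above z w /\ forall v, above z v -> f v - f w <= f w - f z.
  move=> z; have [Bz|nBz] := pselect (B z); last by exists z.
  pose F := f @` above z.
  have Fs : has_sup F.
    split; first by exists (f z), z; rewrite //; exact: above_refl.
    by case: fub => M MB; exists M => _ [w [Bw _] <-]; apply: MB; exists w.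
  have F_le v : above z v -> f v <= sup F.
    by move=> zv; apply: sup_upper_bound => //; exists v.
  have := F_le _ (above_refl _ Bz); rewrite le_eqVlt => /predU1P[zs|zs].
    exists z => _; split; first exact: above_refl.
    by move=> v /F_le; rewrite -zs subrr subr_le0.
  have d0 : 0 < (sup F - f z) / 2 by rewrite divr_gt0// subr_gt0.
  have [_ [w zw <-] wd] := sup_adherent d0 Fs; exists w => _; split=> // v /F_le.
  by move: wd; lra.
pose u n := iter n next b0.
have Bu n : B (u n).
  by elim: n => // n /nextP[[]].
have uS n : above (u n) (u n.+1) by have [] := nextP _ (Bu n).
have above_u m n : (m <= n)%N -> above (u m) (u n).
  elim: n => [|n ih]; first by rewrite leqn0 => /eqP ->; exact: above_refl.
  rewrite leq_eqVlt => /predU1P[->|]; first exact: above_refl.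
  by rewrite ltnS => /ih mn; exact: above_trans mn (uS n).
have fu_nd : nondecreasing_seq (f \o u) by move=> m n /above_u/above_le.
have fu_cvg : cvgn (f \o u).
  apply: nondecreasing_is_cvgn => //; case: fub => M MB; exists M => _ [n _ <-].
  by apply: MB; exists (u n).
have u_cvg : cvgn u.
  apply: cauchy_cvg; apply: cauchy_exP => d' d'0.
  have dE := toRK (ltW d'0); set d := toR d' in dE.
  have d0 : 0 < d by rewrite -(@ofR_gt0 _ k) dE.
  have /cvgrPdist_lt/(_ _ (mulr_gt0 e0 d0))[N _ fN] := fu_cvg.
  exists (u N); exists N => // n /= Nn; rewrite -ball_normE /= -rnormE -dE ltr_ofR.
  rewrite rnormB -(ltr_pM2l e0); have [_ /le_lt_trans] := above_u _ _ Nn; apply.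
  apply: le_lt_trans (fN N (leqnn N)); rewrite (le_trans _ (ler_norm _))// lerB//.
  exact: (nondecreasing_cvgn_le fu_nd).
pose z0 := limn u; have uz0 : u @ \oo --> z0 by [].
have fuz0 : f \o u @ \oo --> f z0 by apply: continuous_cvg => //; exact: fcont.
have Bz0 : B z0 by apply: (closed_cvg _ Bcl _ _ uz0); exact: nearW.
have u_above n : above (u n) z0.
  split=> //; have rn : (fun m => e * rnorm (u m - u n)) @ \oo -->
      (e * rnorm (z0 - u n) : R).
    apply: cvgMl_tmp; apply: continuous_cvg; first exact: rnorm_continuous.
    by apply: cvgB => //; exact: cvg_cst.
  have fn : (fun m => f (u m) - f (u n)) @ \oo --> (f z0 - f (u n) : R).
    by apply: cvgB => //; exact: cvg_cst.
  apply: (ler_cvg_to rn fn); exists n => // m /= nm.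
  by have [] := above_u _ _ nm.
exists z0 => // z Bz; rewrite leNgt; apply/negP => z0z.
have zz0 : above z0 z by split=> //; move: z0z; lra.
suff : f z <= f z0.
  by move: z0z; rewrite leNgt => /(le_lt_trans _) ->//; rewrite lerDl mulr_ge0 ?rnorm_ge0 ?ltW.
have gain : (fun n => f (u n.+1) + (f (u n.+1) - f (u n))) @ \oo -->
    (f z0 + (f z0 - f z0) : R).
  have fuS : (fun n => f (u n.+1)) @ \oo --> f z0 by have := fuz0; rewrite -(cvg_shiftS (f \o u)).
  by apply: cvgD => //; apply: cvgB.
rewrite subrr addr0 in gain.
apply: (ler_cvg_to (cvg_cst (f z)) gain); apply: nearW => n.
have [_ /(_ z (above_trans _ _ _ (u_above n) zz0))] := nextP _ (Bu n).
by rewrite /=; lra.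
Qed.

(** The last bound says that f + h attains its norm over the unit ball at [z0].
    Ekeland's principle gives a point [z0] of the ball from which [f] increases
    inside the ball at rate at most [e]. What is asked of [h] is then
    h (z0 - z) >= f z - f z0 on the ball, where the right-hand side is at most
    e * rnorm (z0 - z). *)
Theorem bishop_phelps (Z : completeNormedModType K)
    (f : {linear realification Z -> R^o}) (c e : R) :
  0 < e -> 0 <= c -> (forall z : Z, f z <= c * rnorm z) ->
  exists (h : {linear realification Z -> R^o}) (z0 : Z),
    [/\ forall z : Z, h z <= e * rnorm z, rnorm z0 <= 1 &
        forall z : Z, f z + h z <= (f z0 + h z0) * rnorm z].
Proof.
move=> e0 c0 fc.
have fZ t v : f (t *: v) = t * f v by exact: linearZ.
have [||| |z0 z01 z0P] := @ekeland Z [set z | rnorm z <= 1] f e e0.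
- apply: (@preimage_closed _ _ (@rnorm R k Z) [set x | x <= 1]).
    by move=> z _; exact: rnorm_continuous.
  exact: closed_le.
- by exists 0; rewrite /= rnorm0.
- by exists c => _ [z z1 <-]; rewrite (le_trans (fc _))// ler_piMr.
- by apply: (@lipschitz_continuous _ _ _ f c c0) => u v; rewrite -linearB.
(* The pairs (z0 - z, f z - f z0), for z in the ball, times t, with w = t z: in
   this form the stability under sums is immediate. *)
pose A : set (realification Z * R) := [set ar | exists t (w : realification Z),
  [/\ 0 <= t, rnorm (w : Z) <= t & ar = (t *: (z0 : realification Z) - w, f w - t * f z0)]].
have [|_ _ [t [w [t0 wt [-> ->]]]]|h [he hA]] :=
  mazur_orlicz (fun z : realification Z => e * rnorm (z : Z)) A
    (sublinear_rnorm _ _ (ltW e0)).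
- split.
  + by exists 0, 0; rewrite rnorm0 lexx scale0r subrr mul0r linear0 subrr.
  + move=> _ _ _ _ [t [w [t0 wt [-> ->]]]] [t' [w' [t'0 w't' [-> ->]]]].
    exists (t + t'), (w + w'); split; first exact: addr_ge0.
      by rewrite (le_trans (rnormD _ _))// lerD.
    by congr (_, _); [rewrite scalerDl opprD addrACA|rewrite linearD /=; lra].
  + move=> s _ _ s0 [t [w [t0 wt [-> ->]]]]; exists (s * t), (s *: w).
    split; first exact: mulr_ge0.
      by rewrite rnorm_ofRZ// ler_wpM2l.
    by congr (_, _); [rewrite scalerBr scalerA|rewrite fZ; lra].
- move: t0; rewrite le_eqVlt => /predU1P[t0|t0].
    have -> : w = 0 by apply: (@rnorm_eq0 _ _ Z); apply/le_anti; rewrite rnorm_ge0 t0 wt.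
    by rewrite -t0 mul0r scale0r subrr rnorm0 mulr0 subr0 linear0.
  have wE : w = t *: (t^-1 *: w) by rewrite scalerA divff ?scale1r// lt0r_neq0.
  have w1 : rnorm (t^-1 *: w : Z) <= 1.
    by rewrite rnorm_ofRZ ?invr_ge0 ?(ltW t0)// ler_pdivrMl// mulr1.
  rewrite {}wE -scalerBr fZ -mulrBr [rnorm _]rnorm_ofRZ ?(ltW t0)// mulrCA.
  rewrite ler_wpM2l ?(ltW t0)// [rnorm _](@rnormB _ _ Z) lerBlDl.
  exact: z0P.
exists h, z0; split=> // z.
have : f z - rnorm z * f z0 <= h (rnorm z *: (z0 : realification Z) - z).
  by apply: hA; exists (rnorm z), z; rewrite rnorm_ge0.
rewrite linearB /= (_ : h (rnorm z *: (z0 : realification Z)) = rnorm z * h z0).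
  by move: (f z) (h z) (f z0) (h z0) (rnorm z) => a b a0 b0 n; lra.
exact: linearZ.
Qed.

End bishop_phelps.

(** * Real parts of linear functionals *)

Section real_part.
Context {R : realType} {k : scalar_kind}.
Local Notation K := (scalars R k).

Lemma toRD (a b : K) : toR (a + b) = toR a + toR b.
Proof. by case: k a b => //= -[? ?] [? ?]. Qed.

Lemma toRZ (t : R) (a : K) : toR (ofR t * a) = t * toR a.
Proof. by case: k a => //= -[x y] /=; rewrite mul0r subr0. Qed.

Lemma toR_le_rnorm (a : K) : toR a <= rnorm (a : K^o).
Proof.
rewrite -(@ler_ofR _ k) rnormE; case: k a => [a|a] /=; first exact: ler_norm.
by rewrite (le_trans _ (normc_ge_Re a))// lecE /= eqxx ler_norm.
Qed.

Lemma toR_linear (V : lmodType K) (F : {linear V -> K^o}) :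
  linear (fun v : realification V => toR (F v) : R^o).
Proof.
move=> t u v; rewrite linearD toRD; congr (_ + _).
by rewrite -[RHS]toRZ; congr toR; exact: linearZ.
Qed.

(** Over the complex numbers F v = h v - i h (i v). *)
Lemma linear_of_real_part (V : lmodType K) (h : {linear realification V -> R^o}) :
  exists F : {linear V -> K^o}, forall v, toR (F v) = h v.
Proof.
suff [F Flin Fh] : exists2 F : V -> K^o, linear F & forall v, toR (F v) = h v.
  pose G : {linear V -> K^o} :=
    HB.pack F (GRing.isLinear.Build K V K^o *:%R F Flin).
  by exists G.
have hZ t (w : V) : h ((ofR t : K) *: w) = t * h w by exact: linearZ.
have hD (w w' : V) : h (w + w') = h w + h w' by exact: linearD.
case: k V h hZ hD => V h hZ hD.
  by exists h => // t u v; exact: linearP.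
pose C : numFieldType := scalars R ComplexScalars.
pose i : C := (0 +i* 1)%C.
exists (fun v => (h v +i* - h (i *: v))%C) => // a u v.
have aE : a = ofR (complex.Re a) + ofR (complex.Im a) * i :> C.
  by case: a => x y; rewrite /i /ofR /=; simpc.
have iaE : i * a = ofR (- complex.Im a) + ofR (complex.Re a) * i :> C.
  by case: a {aE} => x y; rewrite /i /ofR /=; simpc.
have -> : i *: (a *: u + v) = (ofR (- complex.Im a) : C) *: u +
    (ofR (complex.Re a) : C) *: (i *: u) + i *: v.
  rewrite scalerDr; congr (_ + _); transitivity ((i * a) *: u).
    exact: scalerA.
  rewrite iaE [LHS]scalerDl; congr (_ + _); exact/esym/scalerA.
have -> : a *: u + v = (ofR (complex.Re a) : C) *: u +
    (ofR (complex.Im a) : C) *: (i *: u) + v.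
  congr (_ + _); rewrite [in LHS]aE [LHS]scalerDl; congr (_ + _).
  exact/esym/scalerA.
rewrite !hD !hZ; case: a {aE iaE} => x y.
by apply/eqP; rewrite eq_complex /=; apply/andP; split; apply/eqP; ring.
Qed.

(** Multiplying the argument by a scalar of modulus 1 turns the modulus of a
    value into a real part. *)
Lemma rnorm_le_of_real_part (V : normedModType K) (F : {linear V -> K^o}) (c : R) :
  (forall v, toR (F v) <= c * rnorm v) ->
  forall v, rnorm (F v) <= c * rnorm v.
Proof.
move=> Fc v; pose a : K := F v.
have [u u1 ua] : exists2 u : K, `|u| = 1 & u * a = `|a|.
  have [->|a0] := eqVneq a 0; first by exists 1; rewrite ?normr1// mulr0 normr0.
  exists (`|a| / a); last by rewrite divfK.
  by rewrite normrM normfV normr_id divff ?normr_eq0.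
have := Fc (u *: v); rewrite linearZ -[X in toR X]/(u * a) ua rnormZ.
by rewrite [rnorm u](_ : _ = 1) ?mul1r// /rnorm u1 -(@ofR1 R k) ofRK.
Qed.

End real_part.

(** * Operators into the dual and functionals on the tensor product *)

Section operators.
Context {R : realType} {k : scalar_kind}.
Local Notation K := (scalars R k).

Lemma rnorm_ptens_le (X Y : normedModType K) (x : X) (y : Y) :
  rnorm (ptens x y) <= rnorm x * rnorm y.
Proof.
rewrite rnorm_completion_inj; have := pi_norm_le [:: (x, y)].
by rewrite /tens_sum /cost !big_seq1.
Qed.

Lemma ptens_linearl (X Y : normedModType K) (y : Y) :
  linear (fun x : X => ptens x y).
Proof. by move=> a x x'; rewrite /ptens linearPl linearP. Qed.

Lemma ptens_linearr (X Y : normedModType K) (x : X) :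
  linear (fun y : Y => ptens x y).
Proof. by move=> a y y'; rewrite /ptens linearPr linearP. Qed.

Lemma op_of_functional (X Y : normedModType K)
    (F : {linear proj_tensor X Y -> K^o}) (c : R) : 0 <= c ->
  (forall z, rnorm (F z) <= c * rnorm z) ->
  exists H : bounded_op X (dual Y),
    opnorm H <= c /\ forall x y, H x y = F (ptens x y).
Proof.
move=> c0 Fc.
have Fxy x y : rnorm (F (ptens x y)) <= c * rnorm x * rnorm y.
  by rewrite (le_trans (Fc _))// -mulrA ler_wpM2l// rnorm_ptens_le.
have Hx x : bounded_linear_pred (fun y : Y => F (ptens x y)).
  apply/asboolP; split; first by move=> a y y'; rewrite ptens_linearr linearP.
  exists (ofR (c * rnorm x)) => y.
  by have := Fxy x y; rewrite -(@ler_ofR _ k) ofRM !rnormE.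
have Hx_le x : opnorm (BoundedOp (Hx x)) <= c * rnorm x.
  apply: opnorm_le => y y1; rewrite (le_trans (Fxy x y))// ler_piMr//.
    by rewrite mulr_ge0 ?rnorm_ge0.
  by rewrite -(@ler_ofR _ k) rnormE ofR1.
have H : bounded_linear_pred (fun x : X => (BoundedOp (Hx x) : dual Y)).
  apply/asboolP; split.
    move=> a x x'; apply/val_inj/funext => y /=.
    by rewrite ptens_linearl linearP.
  exists (ofR c) => x.
  by have := Hx_le x; rewrite -(@ler_ofR _ k) ofRM rnormE.
exists (BoundedOp H); split=> //; apply: opnorm_le => x x1.
rewrite [rnorm _]ofRK (le_trans (Hx_le x))// ler_piMr//.
by rewrite -(@ler_ofR _ k) rnormE ofR1.
Qed.

Lemma rnorm_op_to_dual (X Y : normedModType K) (T : bounded_op X (dual Y)) x y :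
  rnorm (T x y) <= opnorm T * rnorm x * rnorm y.
Proof.
rewrite (le_trans (ler_opnorm _ _))// ler_wpM2r ?rnorm_ge0//.
by have := ler_opnorm T x; rewrite [rnorm (T x)]ofRK.
Qed.

(** The functional is first defined on the algebraic tensor product, where [T]
    is one of the bilinear forms that tensors evaluate. Its extension to the
    completion is a Hahn-Banach extension dominated by opnorm T * rnorm, which
    spares the passage to the limit. *)
Lemma functional_of_op (X Y : normedModType K) (T : bounded_op X (dual Y)) :
  exists f : {linear realification (proj_tensor X Y) -> R^o},
    (forall z : proj_tensor X Y, f z <= opnorm T * rnorm z) /\
    forall x y, f (ptens x y) = toR (T x y).
Proof.
have Tbil : bilinear_for *:%R *:%R (fun x y => T x y : K^o).
  by split=> [y|x] a u v; rewrite !linearP.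
pose B : bilinear_form X Y :=
  HB.pack (fun x y => T x y : K^o)
    (bilinear_isBilinear.Build K X Y K^o *:%R *:%R (fun x y => T x y : K^o) Tbil).
have BvalP : linear (fun t : tensor X Y => tensor_val t B : K^o) by [].
pose Bval : {linear tensor X Y -> K^o} :=
  HB.pack (fun t : tensor X Y => tensor_val t B : K^o)
    (GRing.isLinear.Build K (tensor X Y) K^o *:%R
       (fun t : tensor X Y => tensor_val t B) BvalP).
pose phi : {linear realification (tensor X Y) -> R^o} :=
  HB.pack (fun t : realification (tensor X Y) => toR (Bval t) : R^o)
   (GRing.isLinear.Build R (realification (tensor X Y)) R^o *:%R
     (fun t : realification (tensor X Y) => toR (Bval t)) (toR_linear _ Bval)).
have jlin : linear (fun t : realification (tensor X Y) =>
    completion_inj (pi_seminorm X Y) t : realification (proj_tensor X Y)).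
  by move=> a t u; rewrite linearD; congr (_ + _); exact: linearZ.
pose j : {linear realification (tensor X Y) -> realification (proj_tensor X Y)} :=
  HB.pack (fun t : realification (tensor X Y) =>
    completion_inj (pi_seminorm X Y) t : realification (proj_tensor X Y))
   (GRing.isLinear.Build R (realification (tensor X Y))
     (realification (proj_tensor X Y)) *:%R _ jlin).
have phi_sum s : phi (tens_sum s) = \sum_(xy <- s) toR (T xy.1 xy.2).
  by rewrite /tens_sum; elim/big_rec2: _ => [|xy a b _ ab]; rewrite ?linear0// linearD ab.
have phi_le (t : tensor X Y) : phi t <= opnorm T * rnorm (j t : proj_tensor X Y).
  rewrite rnorm_completion_inj; apply/ler_addgt0Pr => e e0.
  have d0 : 0 < e / (opnorm T + 1) by rewrite divr_gt0// ltr_wpDl// opnorm_ge0.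
  have [s ts sE] := pi_norm_approx t d0.
  have : phi t <= opnorm T * cost s.
    rewrite ts phi_sum mulr_sumr; apply: ler_sum => xy _.
    by rewrite (le_trans (toR_le_rnorm _))// mulrA rnorm_op_to_dual.
  move=> /le_trans; apply.
  have := ler_wpM2l (opnorm_ge0 T) (ltW sE); rewrite mulrDr => /le_trans; apply.
  rewrite lerD2l mulrA ler_pdivrMr ?ltr_wpDl ?opnorm_ge0// mulrC.
  by rewrite ler_wpM2l ?(ltW e0)// lerDl.
have [f [fT fj]] := hahn_banach_extension R _ _ j _ phi
  (sublinear_rnorm (proj_tensor X Y) _ (opnorm_ge0 T)) phi_le.
by exists f; split=> // x y; rewrite [LHS](fj (tens x y)).
Qed.

End operators.

(** * Attaining the operator norm *)

Section attaining.
Context {R : realType} {k : scalar_kind}.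
Local Notation K := (scalars R k).

Lemma exists_unit_vector (V : normedModType K) :
  (exists v : V, v != 0) -> exists v : V, `|v| = 1.
Proof.
move=> [v v0]; exists (`|v|^-1 *: v).
by rewrite normrZ normfV normr_id mulVf// normr_eq0.
Qed.

Lemma opnorm_le_of_real_part (X Y : normedModType K) (S : bounded_op X (dual Y))
    (g : {linear realification (proj_tensor X Y) -> R^o}) (c : R) : 0 <= c ->
  (forall x y, g (ptens x y) = toR (S x y)) ->
  (forall z : proj_tensor X Y, g z <= c * rnorm z) -> opnorm S <= c.
Proof.
move=> c0 gS gc; have le1 (V : normedModType K) (v : V) : `|v| <= 1 -> rnorm v <= 1.
  by move=> v1; rewrite -(@ler_ofR _ k) rnormE ofR1.
apply: opnorm_le => x /le1 x1; rewrite [rnorm _]ofRK.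
apply: opnorm_le => y /le1 y1; apply: (@le_trans _ _ (c * rnorm y)).
  apply: rnorm_le_of_real_part => y'; rewrite -gS (le_trans (gc _))//.
  rewrite ler_wpM2l// (le_trans (rnorm_ptens_le _ _ _ _))//.
  by rewrite ler_piMl ?rnorm_ge0.
by rewrite ler_piMr.
Qed.

(** [g] is the real part of the functional of [S], and it attains its norm at
    [z0]. In an optimal representation of [z0] no value
    g (x_n (x) y_n) can fall short of its bound opnorm S * |x_n| * |y_n|, since
    the bounds add up to at most g z0; a nonzero term then exhibits a vector
    where [S] attains its norm. *)
Lemma norm_attaining_of_max (X Y : normedModType K) (S : bounded_op X (dual Y))
    (g : {linear realification (proj_tensor X Y) -> R^o}) (z0 : proj_tensor X Y) :
  (exists x : X, x != 0) ->
  (forall x y, g (ptens x y) = toR (S x y)) ->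
  (forall z : proj_tensor X Y, g z <= g z0 * rnorm z) ->
  rnorm z0 <= 1 -> pi_attaining X Y z0 ->
  norm_attaining X (dual Y) S.
Proof.
move=> X0 gS gle z01 [xy [_ az bz]].
(* The bound at - z0 reads - g z0 <= g z0 * rnorm z0. *)
have gz0 : 0 <= g z0.
  have : g (- z0) <= g z0 * rnorm (- z0) by exact: gle.
  rewrite linearN /= /rnorm normrN -/(rnorm z0) => gN.
  have : 0 <= g z0 * (1 + rnorm z0) by move: gN; rewrite mulrDr mulr1; lra.
  by rewrite pmulr_lge0// ltr_pwDl// rnorm_ge0.
have Sg : opnorm S <= g z0 by exact: opnorm_le_of_real_part gz0 gS gle.
set a := fun n => _ in az; set b := fun n => _ in bz.
have gb_le n : g (b n) <= opnorm S * a n.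
  by rewrite gS (le_trans (toR_le_rnorm _))// mulrA rnorm_op_to_dual.
have gcont : continuous (g : proj_tensor X Y -> R).
  apply: (@lipschitz_continuous _ _ _ g _ gz0) => u v.
  by rewrite -linearB gle.
(* The shortfall of the nth term: it is nonnegative, and the total is at most 0. *)
pose d n := opnorm S * a n - g (b n).
have gap_cvg : series d @ \oo --> (opnorm S * rnorm z0 - g z0 : R).
  have -> : series d = fun n => opnorm S * series a n - g (series b n).
    apply/funext => n; rewrite /series /= big_split /= mulr_sumr sumrN.
    by congr (_ - _); elim/big_rec2: _ => [|i x y _ ->]; rewrite ?linear0 ?linearD.
  apply: cvgB; first exact: cvgMl_tmp.
  apply: (@continuous_cvg _ (proj_tensor X Y) _ _ _ (series b) g z0) => //.
  exact: gcont.
have d_ge0 n : 0 <= d n by rewrite subr_ge0.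
have d_nd : nondecreasing_seq (series d).
  by apply: nondecreasing_series => n _ _.
have d0 n : d n <= 0.
  have sd0 : series d n.+1 <= 0.
    have := nondecreasing_cvgn_le d_nd (cvgP _ gap_cvg) n.+1.
    rewrite (cvg_lim _ gap_cvg)//; move=> /le_trans; apply.
    by rewrite subr_le0 (le_trans _ Sg)// ler_piMr// opnorm_ge0.
  apply: le_trans sd0; rewrite seriesSr lerDr.
  by rewrite /series /= sumr_ge0.
have [[n an0]|a0] := pselect (exists n, a n != 0); last first.
  have S0 : opnorm S = 0.
    have z00 : rnorm z0 = 0.
      apply: (cvg_unique _ az) => //.
      rewrite (_ : series a = cst 0); first exact: cvg_cst.
      apply/funext => n; rewrite /series /= big1// => i _.
      by apply/eqP/negP => /negP ai; apply: a0; exists i.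
    apply/le_anti; rewrite opnorm_ge0 andbT (le_trans Sg)//.
    by rewrite (le_trans (gle _))// z00 mulr0.
  have [v v1] := exists_unit_vector _ X0; exists v => //.
  rewrite -rnormE; congr ofR; rewrite S0; apply/le_anti; rewrite rnorm_ge0 andbT.
  by rewrite (le_trans (ler_opnorm _ _))// S0 mul0r.
move: (d0 n) an0; rewrite /d /a /b; case: (xy n) => x y /=.
rewrite subr_le0 mulf_eq0 negb_or => dxy /andP[x0 y0].
have {}x0 : 0 < rnorm x by rewrite lt_def x0 rnorm_ge0.
have {}y0 : 0 < rnorm y by rewrite lt_def y0 rnorm_ge0.
have Sx : opnorm S * rnorm x <= rnorm (S x).
  rewrite -(ler_pM2r y0) -mulrA (le_trans dxy)// gS.
  rewrite (le_trans (toR_le_rnorm _))// (le_trans (ler_opnorm _ _))//.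
  by rewrite [rnorm (S x)]ofRK.
exists ((ofR (rnorm x)^-1 : K) *: x).
  by rewrite -rnormE rnorm_ofRZ ?invr_ge0 ?rnorm_ge0// mulVf ?lt0r_neq0// ofR1.
rewrite -rnormE; congr ofR; rewrite linearZ rnorm_ofRZ ?invr_ge0 ?rnorm_ge0//.
apply/le_anti/andP; split; first by rewrite ler_pdivrMl// mulrC ler_opnorm.
by rewrite ler_pdivlMl// mulrC.
Qed.

End attaining.

Theorem corollary3p11 (R : realType) (k : scalar_kind)
    (X Y : completeNormedModType (scalars R k))
    (X_neq0 : exists x : X, x != 0) (Y_neq0 : exists y : Y, y != 0) :
  pi_attaining X Y = setT ->
  closure (norm_attaining X (dual Y)) = setT.
Proof.
move=> attain; apply/seteqP; split=> // T _ U /nbhs_ballP[eps' /= eps'0 TU].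
have epsE := toRK (ltW eps'0); set eps := toR eps' in epsE.
have eps0 : 0 < eps by rewrite -(@ofR_gt0 _ k) epsE.
have e0 : 0 < eps / 2 by rewrite divr_gt0.
have [f [fT fxy]] := functional_of_op _ _ T.
have [h [z0 [he z01 hmax]]] := bishop_phelps _ f _ _ e0 (opnorm_ge0 T) fT.
have [F Fh] := linear_of_real_part (proj_tensor X Y) h.
have [|H [He Hxy]] := op_of_functional X Y F (eps / 2) (ltW e0).
  by apply: rnorm_le_of_real_part => z; rewrite Fh.
pose S : bounded_op X (dual Y) := T + H.
pose g : {linear realification (proj_tensor X Y) -> R^o} := f \+ h.
have gS x y : g (ptens x y) = toR (S x y).
  by rewrite /g /= fxy -Fh -Hxy -toRD.
exists S; split.
  apply: (norm_attaining_of_max _ _ S g z0) => //; last by rewrite attain.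
apply: TU; rewrite -ball_normE /=.
have -> : T - S = - H by rewrite /S opprD addNKr.
rewrite normrN -epsE; rewrite [`|H|](_ : _ = ofR (opnorm H))// ltr_ofR.
by rewrite (le_lt_trans He)// ltr_pdivrMr// ltr_pMr// ltr1n.
Qed.
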